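(* (1) For every pointed topological space $X$, the counit $\varepsilon\colon \nu X \to X$ (the identity on underlying sets) is a weak homotopy equivalence. (2) If $X$ is a pointed numerically generated space and $Y$ is a pointed topological space, then the bijection $\iota\colon \mathbf{map}_0(X,Y)\to\mathbf{smap}_0(X,Y)$ given by inclusion is a weak homotopy equivalence.
   Context: A topological space $X$ is numerically generated if it has the final topology with respect to all its singular simplexes (continuous maps $\Delta^n\to X$, $n\ge0$). For a topological space $X$, $\nu X$ is the underlying set of $X$ with the final topology with respect to all continuous maps into $X$ from open subsets of Euclidean spaces (equivalently, with respect to the singular simplexes of $X$); the identity map $\nu X\to X$ is the counit $TDX \to X$ of the adjunction between the functor $D$ from topological to diffeological spaces (plots of $DX$ are the continuous maps into $X$ from open subsets of Euclidean spaces) and its left adjoint $T$ (final topology with respect to plots), where $\nu=TD$. A map $f\colon X\to Y$ of topological spaces is numerically continuous if $f\sigma$ is continuous for every singular simplex $\sigma\colon\Delta^n\to X$. $\mathbf{map}(X,Y)$ is the set of continuous maps with the compact-open topology. $\mathbf{smap}(X,Y)$ is the set of numerically continuous maps with the initial topology with respect to the maps $\sigma^*\colon\mathbf{smap}(X,Y)\to\mathbf{map}(\Delta^n,Y)$, $f\mapsto f\sigma$, for all singular simplexes $\sigma$ of $X$. For pointed spaces, $\mathbf{map}_0(X,Y)$ and $\mathbf{smap}_0(X,Y)$ are the subspaces of basepoint preserving maps of $\mathbf{map}(X,Y)$ and $\mathbf{smap}(X,Y)$ respectively. When $X$ is numerically generated every numerically continuous map out of $X$ is continuous, so $\iota$ is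 a bijection. *)

(* Defs.v *)
From HB Require Import structures.
From mathcomp Require Import all_boot all_order all_algebra generic_quotient.
From mathcomp Require Import mathcomp_extra boolp classical_sets functions.
From mathcomp Require Import interval_inference reals topology normedtype.
From mathcomp Require Import ring lra.

Set Implicit Arguments.
Unset Strict Implicit.
Unset Printing Implicit Defensive.

Import Order.TTheory GRing.Theory Num.Theory.
Import numFieldTopology.Exports numFieldNormedType.Exports.

Local Open Scope classical_set_scope.
Local Open Scope ring_scope.
Local Open Scope quotient_scope.

Lemma continuous_row (R : realType) (T : topologicalType) n
    (f : T -> 'rV[R]_n) :
  (forall i, continuous (fun x => f x ord0 i)) -> continuous f.
Proof.
move=> fc x A [P Px PA]; rewrite nbhs_simpl /=.
suff : \forall y \near x, forall i j, P i j (f y i j).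
  by apply: filterS => y Py; exact: PA.
apply: filter_forall => i; apply: filter_forall => j.
by rewrite (ord1 i) in Px *; apply: fc; exact: Px.
Qed.

Lemma continuous_paste (R : realType) (T X : topologicalType) (h : T -> R)
    (c : R) (f g : T -> X) :
  continuous h -> continuous f -> continuous g ->
  (forall x, h x = c -> f x = g x) ->
  continuous (fun x => if h x <= c then f x else g x).
Proof.
move=> hc fc gc fg x; case: (ltgtP (h x) c) => hxc A /=.
- rewrite (ltW hxc) => fA; rewrite nbhs_simpl /=.
  have hN : \forall y \near x, h y < c.
    exact: (cvgr_lt (h x) (hc x)).
  near=> y; have hy : h y < c by near: y.
  rewrite /= (ltW hy); near: y; exact: fc.
- rewrite leNgt hxc /= => fA; rewrite nbhs_simpl /=.
  have hN : \forall y \near x, c < h y.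
    exact: (cvgr_gt (h x) (hc x)).
  near=> y; have hy : c < h y by near: y.
  by rewrite /= leNgt hy /=; near: y; exact: gc.
- rewrite hxc lexx => fA; rewrite nbhs_simpl /=; near=> y => /=; case: ifP => _; near: y.
    exact: fc.
  by apply: gc; rewrite -(fg _ hxc).
Unshelve. all: by end_near. Qed.

Lemma continuous_to_set (T X : topologicalType) (A : set X) (f : T -> A) :
  continuous (fun x => set_val (f x)) -> continuous f.
Proof. exact: (@continuous_comp_initial A T X set_val f). Qed.

Lemma continuous_set_val (X : topologicalType) (A : set X) :
  continuous (set_val : A -> X).
Proof. exact: initial_continuous. Qed.

Lemma continuous_compf (T X Y : topologicalType) (f : T -> X) (g : X -> Y) :
  continuous f -> continuous g -> continuous (fun x => g (f x)).
Proof. by move=> fc gc x; apply: continuous_comp; [exact: fc | exact: gc]. Qed.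

Lemma continuous_pairf (T X Y : topologicalType) (f : T -> X) (g : T -> Y) :
  continuous f -> continuous g -> continuous (fun x => (f x, g x)).
Proof. by move=> fc gc x; apply: cvg_pair; [exact: fc | exact: gc]. Qed.

Lemma continuous_fstf (X Y : topologicalType) :
  continuous (fst : (X * Y)%type -> X).
Proof. by move=> x; exact: cvg_fst. Qed.

Lemma continuous_sndf (X Y : topologicalType) :
  continuous (snd : (X * Y)%type -> Y).
Proof. by move=> x; exact: cvg_snd. Qed.

Lemma continuous_affine (R : realType) (T : topologicalType) (f : T -> R) k c :
  continuous f -> continuous (fun x => k * f x + c).
Proof.
move=> fc x; apply: (@cvgD _ R^o); last exact: cvg_cst.
by apply: cvgM; [exact: cvg_cst | exact: fc].
Qed.

Section unit_interval.
Variable R : realType.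

Definition unit_itv : set R := [set r | 0 <= r <= 1].

Definition clamp01 (r : R) : R := Num.max 0 (Num.min 1 r).

Lemma clamp01_itv r : 0 <= clamp01 r <= 1.
Proof. by rewrite /clamp01 le_max lexx ge_max ler01 ge_min lexx. Qed.

Lemma clamp01_id r : 0 <= r <= 1 -> clamp01 r = r.
Proof. by move=> /andP[r0 r1]; rewrite /clamp01 min_r// max_r. Qed.

Lemma continuous_clamp01 : continuous clamp01.
Proof.
move=> r; have minc : {for r, continuous (fun r : R => Num.min 1 r : R^o)}.
  exact: (@continuous_min _ _ (cst 1) id r (@cvg_cst _ _ _ _ _) (@cvg_id _ _)).
exact: (@continuous_max _ _ (cst 0) _ r (@cvg_cst _ _ _ _ _) minc).
Qed.

Definition to_unit_itv (r : R) : unit_itv :=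
  exist _ (clamp01 r) (mem_set (clamp01_itv r)).

Lemma unit_itvP (s : unit_itv) : 0 <= set_val s <= 1.
Proof. exact: (set_mem (valP s)). Qed.

Lemma to_unit_itvK (s : unit_itv) : to_unit_itv (set_val s) = s.
Proof. by apply: val_inj => /=; apply: clamp01_id; exact: unit_itvP. Qed.

Lemma continuous_to_unit_itv : continuous to_unit_itv.
Proof. by apply: continuous_to_set; exact: continuous_clamp01. Qed.

Lemma mem_unit_itv0 : unit_itv 0. Proof. by rewrite /unit_itv /= lexx ler01. Qed.
Lemma mem_unit_itv1 : unit_itv 1. Proof. by rewrite /unit_itv /= lexx ler01. Qed.

Definition itv0 : unit_itv := exist _ 0 (mem_set mem_unit_itv0).
Definition itv1 : unit_itv := exist _ 1 (mem_set mem_unit_itv1).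

Lemma itv0E : set_val itv0 = 0 :> R. Proof. by []. Qed.
Lemma itv1E : set_val itv1 = 1 :> R. Proof. by []. Qed.

(* s |-> k s + c; the clamping only makes it total *)
Definition itv_affine (k c : R) (s : unit_itv) : unit_itv :=
  to_unit_itv (k * set_val s + c).

Lemma continuous_itv_affine k c : continuous (itv_affine k c).
Proof.
apply: continuous_compf continuous_to_unit_itv.
exact/continuous_affine/continuous_set_val.
Qed.

Lemma itv_affineE k c s r :
  k * set_val s + c = set_val r -> itv_affine k c s = r.
Proof. by move=> e; rewrite /itv_affine e to_unit_itvK. Qed.

End unit_interval.
Arguments unit_itv R _ : clear implicits.

Section homotopy.
Variables (R : realType) (T X : topologicalType) (A : set T).

Definition homotopic_rel (f g : T -> X) : Prop :=
  exists H : (unit_itv R * T)%type -> X,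
    [/\ continuous H,
        forall t, H (itv0 R, t) = f t,
        forall t, H (itv1 R, t) = g t
      & forall s t, A t -> H (s, t) = f t].

Lemma continuous_reparam (H : (unit_itv R * T)%type -> X) k c :
  continuous H -> continuous (fun p => H (itv_affine k c p.1, p.2)).
Proof.
move=> Hc; apply: continuous_compf Hc.
apply: continuous_pairf; last exact: continuous_sndf.
exact: continuous_compf (@continuous_fstf _ _) (@continuous_itv_affine _ _ _).
Qed.

Lemma homotopic_rel_refl f : continuous f -> homotopic_rel f f.
Proof.
move=> fc; exists (fun p => f p.2); split=> //.
exact: continuous_compf (@continuous_sndf _ _) fc.
Qed.

Lemma homotopic_rel_sym f g : homotopic_rel f g -> homotopic_rel g f.
Proof.
move=> [H [Hc H0 H1 HA]]; exists (fun p => H (itv_affine (-1) 1 p.1, p.2)).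
have e0 : itv_affine (-1) 1 (itv0 R) = itv1 R.
  by apply: itv_affineE; rewrite itv0E itv1E mulr0 add0r.
have e1 : itv_affine (-1) 1 (itv1 R) = itv0 R.
  by apply: itv_affineE; rewrite itv0E itv1E mulr1 addNr.
split=> [|t|t|s t At].
- exact: continuous_reparam.
- by rewrite /= e0.
- by rewrite /= e1.
- by rewrite /= HA// -H1 HA.
Qed.

Lemma homotopic_rel_trans f g h :
  homotopic_rel f g -> homotopic_rel g h -> homotopic_rel f h.
Proof.
move=> [H [Hc H0 H1 HA]] [K [Kc K0 K1 KA]].
exists (fun p => if set_val p.1 <= 2^-1 then H (itv_affine 2 0 p.1, p.2)
                 else K (itv_affine 2 (-1) p.1, p.2)).
split=> [|t|t|s t At] /=.
- apply: continuous_paste; try exact: continuous_reparam.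
    exact: continuous_compf (@continuous_fstf _ _) (@continuous_set_val _ _).
  move=> [s t] /= e.
  rewrite (@itv_affineE _ _ _ _ (itv1 R)) ?e /=; last by rewrite ?itv0E ?itv1E; lra.
  rewrite (@itv_affineE _ _ _ _ (itv0 R)) ?e /=; last by rewrite ?itv0E ?itv1E; lra.
  by rewrite H1 K0.
- rewrite itv0E ifT; last by lra.
  by rewrite (@itv_affineE _ _ _ _ (itv0 R)) //= ?itv0E ?itv1E; lra.
- rewrite itv1E ifF; last by apply/negbTE; rewrite -ltNge; lra.
  by rewrite (@itv_affineE _ _ _ _ (itv1 R)) //= ?itv0E ?itv1E; lra.
- by case: ifP => _; [rewrite HA | rewrite KA// -H1 HA].
Qed.

End homotopy.

Section path_components.
Variables (R : realType) (X : topologicalType).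

Definition path_joined (a b : X) : Prop :=
  exists p : unit_itv R -> X, [/\ continuous p, p (itv0 R) = a & p (itv1 R) = b].

Lemma path_joined_homotopic a b :
  path_joined a b <-> homotopic_rel R set0 (fun _ : bool => a) (fun=> b).
Proof.
split=> [[p [pc <- <-]]|[H [Hc H0 H1 _]]].
  exists (fun q => p q.1); split=> //.
  exact: continuous_compf (@continuous_fstf _ _) pc.
exists (fun s => H (s, true)); split=> //; apply: continuous_compf Hc.
by apply: continuous_pairf; [move=> ? | exact: cst_continuous].
Qed.

Definition path_joinedb (a b : X) : bool := `[< path_joined a b >].

Lemma path_joinedb_refl : reflexive path_joinedb.
Proof.
move=> a; apply/asboolP/path_joined_homotopic/homotopic_rel_refl.
exact: cst_continuous.
Qed.

Lemma path_joinedb_sym : symmetric path_joinedb.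
Proof.
move=> a b; apply/asboolP/asboolP => /path_joined_homotopic h;
by apply/path_joined_homotopic/homotopic_rel_sym.
Qed.

Lemma path_joinedb_trans : transitive path_joinedb.
Proof.
move=> b a c /asboolP/path_joined_homotopic ab /asboolP/path_joined_homotopic bc.
by apply/asboolP/path_joined_homotopic; exact: homotopic_rel_trans ab bc.
Qed.

Definition path_equiv :=
  EquivRel path_joinedb path_joinedb_refl path_joinedb_sym path_joinedb_trans.

Definition pi0 := {eq_quot path_equiv}.
HB.instance Definition _ := Choice.on pi0.
HB.instance Definition _ := EqQuotient.on pi0.

End path_components.

Section cube.
Variable R : realType.

Definition cube n : set 'rV[R]_n := [set t | forall i, 0 <= t ord0 i <= 1].
Arguments cube n _ : clear implicits.

Definition cube_boundary n : set (cube n) :=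
  [set t : cube n | exists i, set_val t ord0 i = 0 \/ set_val t ord0 i = 1].
Arguments cube_boundary n _ : clear implicits.

Lemma cubeP n (t : cube n) i : 0 <= set_val t ord0 i <= 1.
Proof. exact: (set_mem (valP t)). Qed.

Lemma cube_clamp_subproof n (v : 'rV[R]_n) : cube n (\row_i clamp01 (v ord0 i)).
Proof. by move=> i; rewrite mxE clamp01_itv. Qed.

Definition cube_clamp n (v : 'rV[R]_n) : cube n :=
  exist _ (\row_i clamp01 (v ord0 i)) (mem_set (cube_clamp_subproof v)).

Lemma continuous_cube_clamp n : continuous (@cube_clamp n).
Proof.
apply: continuous_to_set; apply: continuous_row => i v /=.
rewrite (_ : (fun x : 'rV[R]_n => _) = fun x => clamp01 (x ord0 i)); last first.
  by apply/funext => x; rewrite mxE.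
move: v; apply: continuous_compf (@continuous_clamp01 R).
exact: coord_continuous.
Qed.

(* [cube_stretch c] sends (t_0, t_1, ...) to (2 t_0 - c, t_1, ...); the
   clamping only makes it total, and is inactive for t_0 <= 1/2 when c = 0 and
   for 1/2 <= t_0 when c = 1. *)
Definition cube_stretch n (c : R) (t : cube n.+1) : cube n.+1 :=
  cube_clamp (\row_i (if i == ord0 then 2 * set_val t ord0 i - c
                      else set_val t ord0 i)).

Lemma continuous_coord n i : continuous (fun t : cube n => set_val t ord0 i).
Proof.
apply: (@continuous_compf (cube n) 'rV[R]_n R set_val (fun v => v ord0 i)).
  exact: continuous_set_val.
exact: coord_continuous.
Qed.

Lemma continuous_cube_stretch n c : continuous (@cube_stretch n c).
Proof.
apply: continuous_compf (@continuous_cube_clamp _).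
apply: continuous_row => i.
under eq_fun do rewrite mxE.
case: eqP => _; last exact: continuous_coord.
exact/continuous_affine/continuous_coord.
Qed.

Lemma cube_stretch_boundary n (t : cube n.+1) (c : R) :
  (c = 0 /\ set_val t ord0 ord0 <= 2^-1) \/
  (c = 1 /\ 2^-1 <= set_val t ord0 ord0) ->
  cube_boundary _ t -> cube_boundary _ (cube_stretch c t).
Proof.
move=> hc [i hi]; have t0 := cubeP t ord0.
have [i0|i0] := eqVneq i ord0; last first.
  by exists i; rewrite /= !mxE (negbTE i0) clamp01_id// cubeP.
rewrite {}i0 in hi; exists ord0; rewrite /= !mxE eqxx.
by rewrite clamp01_id; move: hc => [] [-> hc]; lra.
Qed.

Lemma cube_stretch_half n (t : cube n.+1) c : c = 0 \/ c = 1 ->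
  set_val t ord0 ord0 = 2^-1 -> cube_boundary _ (cube_stretch c t).
Proof.
move=> hc t0; exists ord0; rewrite /= !mxE eqxx t0.
by rewrite clamp01_id; case: hc => ->; lra.
Qed.

End cube.
Arguments cube R n _ : clear implicits.
Arguments cube_boundary R n _ : clear implicits.

(* [gloop R n x]: maps of pairs (I^n, boundary of I^n) -> (X, x). *)
Record gloop (R : realType) (X : topologicalType) (n : nat) (x : X) := GLoop {
  gloop_fun :> cube R n -> X ;
  gloop_continuous : continuous gloop_fun ;
  gloop_boundary : forall t, cube_boundary R n t -> gloop_fun t = x }.
Arguments gloop R {X} n x.

HB.instance Definition _ R X n x := gen_eqMixin (@gloop R X n x).
HB.instance Definition _ R X n x := gen_choiceMixin (@gloop R X n x).

Section homotopy_group.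
Variables (R : realType) (X : topologicalType).

Definition gloop_homotopic n (x : X) (a b : gloop R n x) : bool :=
  `[< homotopic_rel R (cube_boundary R n) a b >].

Lemma gloop_homotopic_refl n x : reflexive (@gloop_homotopic n x).
Proof.
move=> a; apply/asboolP/homotopic_rel_refl; exact: gloop_continuous.
Qed.

Lemma gloop_homotopic_sym n x : symmetric (@gloop_homotopic n x).
Proof. by move=> a b; apply/asboolP/asboolP => /homotopic_rel_sym. Qed.

Lemma gloop_homotopic_trans n x : transitive (@gloop_homotopic n x).
Proof.
move=> b a c /asboolP ab /asboolP bc; apply/asboolP.
exact: homotopic_rel_trans ab bc.
Qed.

Definition gloop_equiv n x := EquivRel (@gloop_homotopic n x)
  (@gloop_homotopic_refl n x) (@gloop_homotopic_sym n x)
  (@gloop_homotopic_trans n x).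

Definition homotopy_group n x := {eq_quot (gloop_equiv n x)}.
HB.instance Definition _ n x := Choice.on (homotopy_group n x).
HB.instance Definition _ n x := EqQuotient.on (homotopy_group n x).

Lemma homotopy_group_eqP n x (a b : gloop R n x) :
  reflect (\pi_(homotopy_group n x) a = \pi b) (gloop_homotopic a b).
Proof. exact: eqmodP. Qed.

Lemma gloop_repr_homotopic n x (a : gloop R n x) :
  gloop_homotopic (repr (\pi_(homotopy_group n x) a)) a.
Proof. by apply/homotopy_group_eqP; rewrite reprK. Qed.

Section product.
Variables (n : nat) (x : X).

Definition gloop_concat_fun (a b : cube R n.+1 -> X) (t : cube R n.+1) : X :=
  if set_val t ord0 ord0 <= 2^-1 then a (cube_stretch 0 t)
  else b (cube_stretch 1 t).

Lemma gloop_concat_continuous (a b : gloop R n.+1 x) :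
  continuous (gloop_concat_fun a b).
Proof.
apply: continuous_paste.
- exact: continuous_coord.
- apply: (@continuous_compf _ _ _ (cube_stretch _)).
    exact: continuous_cube_stretch.
  exact: gloop_continuous.
- apply: (@continuous_compf _ _ _ (cube_stretch _)).
    exact: continuous_cube_stretch.
  exact: gloop_continuous.
- move=> t t0; rewrite !gloop_boundary //; apply: cube_stretch_half => //.
    by right.
  by left.
Qed.

Lemma gloop_concat_boundary (a b : gloop R n.+1 x) t :
  cube_boundary _ _ t -> gloop_concat_fun a b t = x.
Proof.
move=> tb; rewrite /gloop_concat_fun; case: leP => t0;
  apply: gloop_boundary; apply: cube_stretch_boundary => //; first by left.
by right; split => //; exact: ltW.
Qed.

Definition gloop_concat (a b : gloop R n.+1 x) : gloop R n.+1 x :=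
  GLoop (@gloop_concat_continuous a b) (@gloop_concat_boundary a b).

(* Defined on representatives; independent of them by [homotopy_group_mulE]. *)
Definition homotopy_group_mul (c d : homotopy_group n.+1 x) :
    homotopy_group n.+1 x :=
  \pi_(homotopy_group n.+1 x) (gloop_concat (repr c) (repr d)).

Lemma gloop_concat_homotopic (a a' b b' : gloop R n.+1 x) :
  gloop_homotopic a a' -> gloop_homotopic b b' ->
  gloop_homotopic (gloop_concat a b) (gloop_concat a' b').
Proof.
move=> /asboolP[H [Hc H0 H1 HA]] /asboolP[K [Kc K0 K1 KA]]; apply/asboolP.
have stretchc (L : (unit_itv R * cube R n.+1)%type -> X) c :
    continuous L -> continuous (fun p : (unit_itv R * cube R n.+1)%type => L (p.1, cube_stretch c p.2)).
  move=> Lc; apply: continuous_compf Lc.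
  apply: continuous_pairf; first exact: continuous_fstf.
  exact: continuous_compf (@continuous_sndf _ _) (@continuous_cube_stretch _ _ _).
exists (fun p : (unit_itv R * cube R n.+1)%type =>
  if set_val p.2 ord0 ord0 <= 2^-1 then H (p.1, cube_stretch 0 p.2)
                 else K (p.1, cube_stretch 1 p.2)); split.
- apply: continuous_paste; try exact: stretchc.
    exact: continuous_compf (@continuous_sndf _ _) (@continuous_coord _ _ _).
  move=> [s t] /= t0; have b0 := cube_stretch_half (or_introl erefl) t0.
  have b1 := cube_stretch_half (or_intror erefl) t0.
  by rewrite HA// KA// !gloop_boundary.
- by move=> t /=; rewrite H0 K0.
- by move=> t /=; rewrite H1 K1.
- move=> s t tb /=; rewrite /gloop_concat_fun; case: leP => t0.
    by rewrite HA//; apply: cube_stretch_boundary => //; left.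
  by rewrite KA//; apply: cube_stretch_boundary => //; right; split=> //; exact: ltW.
Qed.

Lemma homotopy_group_mulE (a b : gloop R n.+1 x) :
  homotopy_group_mul (\pi a) (\pi b) = \pi_(homotopy_group n.+1 x) (gloop_concat a b).
Proof.
apply/homotopy_group_eqP.
by apply: gloop_concat_homotopic; exact: gloop_repr_homotopic.
Qed.

End product.
End homotopy_group.
Arguments homotopy_group R {X} n x.
Arguments homotopy_group_mul {R X n x} c d.

Section weak_homotopy_equivalence.
Variables (R : realType) (X Y : topologicalType) (f : continuousType X Y).

Definition pi0_map (c : pi0 R X) : pi0 R Y := \pi_(pi0 R Y) (f (repr c)).

Lemma pi0_mapE (a : X) : pi0_map (\pi a) = \pi_(pi0 R Y) (f a).
Proof.
apply/eqmodP/asboolP.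
have /eqmodP/asboolP[p [pc p0 p1]] :
  \pi_(pi0 R X) (repr (\pi_(pi0 R X) a)) = \pi a by rewrite reprK.
exists (f \o p); split; rewrite /= ?p0 ?p1//.
exact: continuous_compf pc (@cts_fun _ _ f).
Qed.

Section basepoint.
Variables (n : nat) (x : X).

Lemma gloop_comp_continuous (a : gloop R n x) : continuous (f \o a).
Proof. exact: continuous_compf (@gloop_continuous _ _ _ _ a) (@cts_fun _ _ f). Qed.

Lemma gloop_comp_boundary (a : gloop R n x) t :
  cube_boundary R n t -> (f \o a) t = f x.
Proof. by move=> tb /=; rewrite gloop_boundary. Qed.

Definition gloop_comp (a : gloop R n x) : gloop R n (f x) :=
  GLoop (@gloop_comp_continuous a) (@gloop_comp_boundary a).

Definition homotopy_group_map (c : homotopy_group R n x) :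
    homotopy_group R n (f x) :=
  \pi_(homotopy_group R n (f x)) (gloop_comp (repr c)).

Lemma homotopy_group_mapE (a : gloop R n x) :
  homotopy_group_map (\pi a) = \pi_(homotopy_group R n (f x)) (gloop_comp a).
Proof.
apply/homotopy_group_eqP/asboolP.
have /asboolP[H [Hc H0 H1 HA]] := gloop_repr_homotopic a.
exists (f \o H); split=> [|t|t|s t tb] /=; rewrite ?H0 ?H1 ?HA//.
exact: continuous_compf Hc (@cts_fun _ _ f).
Qed.

End basepoint.

(* pi_0 is treated separately, without basepoints, so that the definition is
   also correct for X empty; for n >= 1 the map induced on pi_n must be an
   isomorphism at every basepoint of X, not only at a distinguished one. *)
Definition weak_homotopy_equivalence : Prop :=
  bijective pi0_map /\
  forall (n : nat) (x : X),
    bijective (@homotopy_group_map n.+1 x) /\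
    {morph @homotopy_group_map n.+1 x :
       c d / homotopy_group_mul c d >-> homotopy_group_mul c d}.

End weak_homotopy_equivalence.
Arguments weak_homotopy_equivalence R {X Y} f.

Definition final_topology (I : Type) (Y : I -> topologicalType) (X : choiceType)
  (f : forall i, Y i -> X) : Type := X.

Section final_topology.
Variables (I : Type) (Y : I -> topologicalType) (X : choiceType).
Variable f : forall i, Y i -> X.

Definition final_open (U : set X) : Prop := forall i, open (@f i @^-1` U).

Lemma final_openT : final_open setT.
Proof. by move=> i; rewrite preimage_setT; exact: openT. Qed.

Lemma final_openI : setI_closed final_open.
Proof. by move=> U V oU oV i; rewrite preimage_setI; exact: openI. Qed.

Lemma final_open_bigU (J : Type) (U : J -> set X) :
  (forall j, final_open (U j)) -> final_open (\bigcup_j U j).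
Proof.
by move=> oU i; rewrite preimage_bigcup; apply: bigcup_open => j _; exact: oU.
Qed.

HB.instance Definition _ := Choice.copy (final_topology f) X.
HB.instance Definition _ := isOpenTopological.Build (final_topology f)
  final_openT final_openI final_open_bigU.

End final_topology.

Section numerically_generated.
Variable R : realType.

Definition std_simplex (n : nat) : set 'rV[R]_n.+1 :=
  [set t | (forall i, 0 <= t ord0 i) /\ \sum_i t ord0 i = 1].
Arguments std_simplex n _ : clear implicits.

Record singular_simplex (X : topologicalType) := SingularSimplex {
  simplex_dim : nat ;
  simplex_fun :> continuousType (std_simplex simplex_dim) X }.

(* The plots of D X; X is not required to be nonempty, so a plot is a function
   on the subtype [plot_dom] rather than a total function on 'rV[R]_n. *)
Record plot (X : topologicalType) := Plot {
  plot_dim : nat ;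
  plot_dom : set 'rV[R]_plot_dim ;
  plot_open : open plot_dom ;
  plot_fun :> continuousType plot_dom X }.

Definition numerically_generated (X : topologicalType) : Prop :=
  @open X = final_open (fun s : singular_simplex X => s : _ -> X).

Definition numerically_continuous (X Y : topologicalType) (f : X -> Y) : Prop :=
  forall s : singular_simplex X, continuous (f \o s).

(* nu = T D *)
Definition nu (X : topologicalType) : Type :=
  final_topology (fun p : plot X => p : _ -> X).
HB.instance Definition _ X := Topological.on (nu X).

Lemma nu_openE (X : topologicalType) (U : set X) :
  (open : set (set (nu X))) U = final_open (fun p : plot X => p : _ -> X) U.
Proof. by []. Qed.

Definition counit_fun (X : topologicalType) : nu X -> X := id.

Lemma counit_continuous (X : topologicalType) : continuous (@counit_fun X).
Proof.
apply/continuousP => U oU.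
have : final_open (fun p : plot X => p : _ -> X) U.
  by move=> p; exact: (proj1 (continuousP _) (@cts_fun _ _ (plot_fun p)) U oU).
exact.
Qed.

HB.instance Definition _ X :=
  isContinuous.Build (nu X) X (@counit_fun X) (@counit_continuous X).

Definition counit (X : topologicalType) : continuousType (nu X) X :=
  @counit_fun X.

End numerically_generated.
Arguments std_simplex R n _ : clear implicits.

Section mapping_spaces.
Variable R : realType.

Definition cmap (X Y : topologicalType) : Type := continuousType X Y.
HB.instance Definition _ X Y := Choice.on (cmap X Y).
HB.instance Definition _ X Y := Topological.copy (cmap X Y)
  (initial_topology (fun f : continuousType X Y => f : {compact-open, X -> Y})).

Record smap (X Y : topologicalType) := Smap {
  smap_fun :> X -> Y ;
  smap_numerically_continuous : numerically_continuous R smap_fun }.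
HB.instance Definition _ X Y := gen_eqMixin (smap X Y).
HB.instance Definition _ X Y := gen_choiceMixin (smap X Y).

Definition smap_pullback X Y (s : singular_simplex R X) (f : smap X Y) :
    cmap (std_simplex R (simplex_dim s)) Y :=
  mkcts (@smap_numerically_continuous X Y f s).

HB.instance Definition _ X Y := Topological.copy (smap X Y)
  (sup_topology (fun s : singular_simplex R X =>
     Topological.class (initial_topology (@smap_pullback X Y s)))).

Definition cmap0 (X Y : ptopologicalType) : set (cmap X Y) :=
  [set f | (f : X -> Y) point = point].
Arguments cmap0 X Y _ : clear implicits.

Definition smap0 (X Y : ptopologicalType) : set (smap X Y) :=
  [set f | (f : X -> Y) point = point].
Arguments smap0 X Y _ : clear implicits.

Section iota.
Variables X Y : ptopologicalType.

Lemma continuous_numerically_continuous (f : cmap X Y) :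
  numerically_continuous R f.
Proof.
move=> s; exact: continuous_compf (@cts_fun _ _ (simplex_fun s)) (@cts_fun _ _ f).
Qed.

Definition cmap_smap (f : cmap X Y) : smap X Y :=
  Smap (@continuous_numerically_continuous f).

Lemma cmap_pullback_continuous (s : singular_simplex R X) :
  continuous (fun f : cmap X Y => smap_pullback s (cmap_smap f)).
Proof.
apply: continuous_comp_initial => f.
apply/compact_open_cvgP; first by apply: fmap_filter; exact: nbhs_filter.
move=> K O cK oO fKO.
have csK : compact ((s : _ -> X) @` K).
  apply: continuous_compact => //; apply: continuous_subspaceT.
  exact: (@cts_fun _ _ (simplex_fun s)).
have oW := compact_open_open csK oO.
apply: (@filterS _ _ _ [set g : cmap X Y | (g : X -> Y) @` ((s : _ -> X) @` K) `<=` O]).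
  by move=> g gO _ [t Kt <-]; apply: gO; exists (s t) => //; exists t.
apply: open_nbhs_nbhs; split; last first.
  by move=> _ [_ [t Kt <-] <-]; apply: fKO; exists t.
by exists [set g : {compact-open, X -> Y} | g @` ((s : _ -> X) @` K) `<=` O].
Qed.

Lemma cmap_smap_continuous : continuous cmap_smap.
Proof.
move=> f; apply/cvg_sup; first by apply: fmap_filter; exact: nbhs_filter.
move=> s.
exact: (@continuous_comp_initial _ _ _ (@smap_pullback X Y s) cmap_smap
  (@cmap_pullback_continuous s) f).
Qed.

Definition map_smap_iota_fun (f : cmap0 X Y) : smap0 X Y :=
  exist _ (cmap_smap (set_val f)) (mem_set (set_mem (valP f) : smap0 X Y (cmap_smap (set_val f)))).

Lemma map_smap_iota_continuous : continuous map_smap_iota_fun.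
Proof.
apply: continuous_to_set.
exact: continuous_compf (@continuous_set_val _ _) cmap_smap_continuous.
Qed.

HB.instance Definition _ := isContinuous.Build _ _ map_smap_iota_fun map_smap_iota_continuous.

Definition map_smap_iota : continuousType (cmap0 X Y) (smap0 X Y) := map_smap_iota_fun.

Lemma numerically_continuous_continuous (f : X -> Y) :
  numerically_generated R X -> numerically_continuous R f -> continuous f.
Proof.
move=> gX fc; apply/continuousP => U oU; rewrite gX => s.
exact: (proj1 (continuousP _) (fc s) U oU).
Qed.

Lemma map_smap_iota_bijective : numerically_generated R X -> bijective map_smap_iota.
Proof.
move=> gX.
pose k (g : smap X Y) : cmap X Y :=
  mkcts (numerically_continuous_continuous gX (@smap_numerically_continuous _ _ g)).
pose h (g : smap0 X Y) : cmap0 X Y := exist _ (k (set_val g))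
  (mem_set (set_mem (valP g) : cmap0 X Y (k (set_val g)))).
exists h => g; apply: val_inj; first exact/continuousEP.
by case: g => -[g gc] gp; congr Smap; exact: Prop_irrelevance.
Qed.

End iota.

End mapping_spaces.
Arguments map_smap_iota R X Y : clear implicits.

(* Main.v *)
Require Import Defs.
From mathcomp Require Import all_boot all_order all_algebra generic_quotient.
From mathcomp Require Import boolp classical_sets functions.
From mathcomp Require Import reals topology normedtype.

Set Implicit Arguments.
Unset Strict Implicit.
Unset Printing Implicit Defensive.

Import Order.TTheory GRing.Theory Num.Theory.
Import numFieldTopology.Exports numFieldNormedType.Exports.

Local Open Scope classical_set_scope.
Local Open Scope ring_scope.
Local Open Scope quotient_scope.

(** Both [counit R X] and [map_smap_iota R X Y] are continuous bijections.  A
    continuous bijection [f] is a weak homotopy equivalence as soon as its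
    inverse [g], though possibly discontinuous, takes every continuous map out
    of a Euclidean space to a continuous map: paths, spheroids and their
    homotopies live on the interval, on cubes and on their products, which are
    retracts of Euclidean spaces, so that [g] carries all of them back from the
    target to the source.  This is [weak_homotopy_equivalence_lift].

    For the counit, a continuous map from a Euclidean space to [X] is a plot of
    [X], hence continuous into [nu R X] by definition of the final topology
    ([counit_lift]).

    For [map_smap_iota], let [T] be a Euclidean space and [h] a continuous map
    from [T] to [smap R X Y]; it has to be continuous into the compact-open
    topology ([cmap_continuous_of_smap]).  Restricting to a singular simplex
    [s] of [X] and uncurrying, which is possible because simplexes are locally
    compact, gives a continuous map on the product of the simplex with [T].
    Currying it the other way shows that the adjoint from [X] to the maps from
    [T] to [Y] is continuous along each [s], hence continuous since [X] is
    numerically generated.  As [T] is locally compact and regular, this adjoint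
    can be uncurried, and currying once more in the first variable gives the
    continuity of [h]. *)

(** * Retracts of Euclidean spaces *)

Section euclidean_retract.
Variable R : realType.

Definition euclidean_retract (T : topologicalType) : Prop :=
  exists n (i : T -> 'rV[R]_n) (r : 'rV[R]_n -> T),
    [/\ continuous i, continuous r & cancel i r].

Lemma euclidean_retract_unit_itv : euclidean_retract (unit_itv R).
Proof.
exists 1%N, (fun s => \row_(j < 1) set_val s),
  (fun v => to_unit_itv (v ord0 ord0)); split.
- apply: continuous_row => j; under eq_fun do rewrite mxE.
  exact: continuous_set_val.
- apply: continuous_compf (@continuous_to_unit_itv R).
  exact: coord_continuous.
- by move=> s; rewrite mxE to_unit_itvK.
Qed.

Lemma euclidean_retract_cube n : euclidean_retract (cube R n).
Proof.
exists n, set_val, (@cube_clamp R n); split.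
- exact: continuous_set_val.
- exact: continuous_cube_clamp.
- move=> t; apply: val_inj; apply/rowP => j /=.
  by rewrite mxE clamp01_id// cubeP.
Qed.

Lemma euclidean_retract_prod (S T : topologicalType) :
  euclidean_retract S -> euclidean_retract T ->
  euclidean_retract (S * T)%type.
Proof.
move=> [m [i [r [ic rc ir]]]] [n [j [q [jc qc jq]]]].
exists (m + n)%N, (fun p => row_mx (i p.1) (j p.2)),
  (fun v => (r (lsubmx v), q (rsubmx v))); split.
- apply: continuous_row => k; case: (split_ordP k) => l ->;
    [under eq_fun do rewrite row_mxEl | under eq_fun do rewrite row_mxEr].
  + apply: (@continuous_compf _ _ _ (fun p : S * T => i p.1)
             (fun v : 'rV[R]_m => v ord0 l)); last exact: coord_continuous.
    exact: continuous_compf (@continuous_fstf _ _) ic.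
  + apply: (@continuous_compf _ _ _ (fun p : S * T => j p.2)
             (fun v : 'rV[R]_n => v ord0 l)); last exact: coord_continuous.
    exact: continuous_compf (@continuous_sndf _ _) jc.
- apply: continuous_pairf.
  + apply: continuous_compf rc; apply: continuous_row => k.
    under eq_fun do rewrite mxE; exact: coord_continuous.
  + apply: continuous_compf qc; apply: continuous_row => k.
    under eq_fun do rewrite mxE; exact: coord_continuous.
- by move=> [s t] /=; rewrite row_mxKl row_mxKr ir jq.
Qed.

End euclidean_retract.

(** * A criterion for weak homotopy equivalences *)

Section weak_equivalence_criterion.
Variable R : realType.

Lemma gloop_homotopic_ext (X : topologicalType) n (x : X) (a b : gloop R n x) :
  a =1 b -> gloop_homotopic a b.
Proof.
move=> /funext ab; apply/asboolP; rewrite -ab; apply: homotopic_rel_refl.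
exact: gloop_continuous.
Qed.

(** Composition with [f] commutes on the nose with the concatenation of
    spheroids, since the latter is a case distinction on the source. *)
Lemma homotopy_group_map_morph (X Y : topologicalType) (f : continuousType X Y)
    n (x : X) :
  {morph @homotopy_group_map R X Y f n.+1 x :
     c d / homotopy_group_mul c d >-> homotopy_group_mul c d}.
Proof.
elim/quotW => a; elim/quotW => b.
rewrite homotopy_group_mulE !homotopy_group_mapE homotopy_group_mulE.
apply/homotopy_group_eqP/gloop_homotopic_ext => t /=.
by rewrite /gloop_concat_fun /=; case: ifP.
Qed.

(** Lifting spheroids along [g] gives surjectivity on homotopy groups, and
    lifting homotopies gives injectivity.  Testing on Euclidean spaces is
    enough: if [r] retracts a Euclidean space onto [T] with section [i], then
    [g \o h] is [g \o (h \o r)] composed with [i]. *)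
Lemma weak_homotopy_equivalence_lift (X Y : topologicalType)
    (f : continuousType X Y) (g : Y -> X) :
  cancel f g -> cancel g f ->
  (forall n (h : 'rV[R]_n -> Y), continuous h -> continuous (g \o h)) ->
  weak_homotopy_equivalence R f.
Proof.
move=> fK gK gc.
have lift (T : topologicalType) (h : T -> Y) :
    euclidean_retract R T -> continuous h -> continuous (g \o h).
  move=> [n [i [r [ic rc ir]]]] hc.
  rewrite (_ : g \o h = (g \o (h \o r)) \o i); last first.
    by apply/funext => t /=; rewrite ir.
  apply: continuous_compf ic _; apply: gc; exact: continuous_compf rc hc.
have rI := euclidean_retract_unit_itv R.
have rC := euclidean_retract_cube R.
split.
  rewrite -setTT_bijective; split=> //.
  - move=> c d _ _; elim/quotW: c => a; elim/quotW: d => b.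
    rewrite !pi0_mapE => /eqmodP/asboolP[p [pc p0 p1]].
    apply/eqmodP/asboolP; exists (g \o p).
    by split=> /=; [exact: lift rI pc | rewrite p0 | rewrite p1].
  - by elim/quotW => b _; exists (\pi_(pi0 R X) (g b)) => //;
    rewrite pi0_mapE gK.
move=> n x; split; last exact: homotopy_group_map_morph.
rewrite -setTT_bijective; split=> //.
- move=> c d _ _; elim/quotW: c => a; elim/quotW: d => b.
  rewrite !homotopy_group_mapE => /homotopy_group_eqP/asboolP[H [Hc H0 H1 HA]].
  apply/homotopy_group_eqP/asboolP; exists (g \o H).
  split=> [|t|t|s t tb] /=.
  + exact: lift (euclidean_retract_prod rI (rC _)) Hc.
  + by rewrite H0 /= fK.
  + by rewrite H1 /= fK.
  + by rewrite HA //= fK.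
- elim/quotW => b _.
  have bb t : cube_boundary R n.+1 t -> (g \o b) t = x.
    by move=> tb /=; rewrite gloop_boundary.
  pose a := GLoop (lift _ _ (rC _) (@gloop_continuous _ _ _ _ b)) bb.
  exists (\pi_(homotopy_group R n.+1 x) a) => //; rewrite homotopy_group_mapE.
  by apply/homotopy_group_eqP/gloop_homotopic_ext => t /=; rewrite gK.
Qed.

End weak_equivalence_criterion.

(** * The counit *)

Section counit.
Variables (R : realType) (X : topologicalType).

(** Euclidean space is an open subset of itself, so [h] is a plot; the rest is
    the passage between ['rV[R]_n] and its full subtype. *)
Lemma counit_lift n (h : 'rV[R]_n -> X) :
  continuous h -> continuous (h : 'rV[R]_n -> nu R X).
Proof.
move=> hc; apply/continuousP => U oU.
have hvc : continuous (fun v : [set: 'rV[R]_n] => h (set_val v)).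
  exact: continuous_compf (@continuous_set_val _ _) hc.
have [V oV VU] := oU (Plot openT (mkcts hvc)).
suff -> : h @^-1` U = V by [].
apply/seteqP; split => v.
  by move=> Uv; have : (set_val @^-1` V) (exist _ v (mem_set I)) by rewrite VU.
move=> Vv; have : (set_val @^-1` V) (exist _ v (mem_set I)) by [].
by rewrite VU.
Qed.

End counit.

(** * Mapping spaces and the exponential law *)

Section exponential_law.
Variable R : realType.

(** The trace on [A] of a compact closed neighbourhood [B] is compact because a
    filter on the subtype, pushed forward, clusters in the compact set
    [A `&` B], and the subtype has the initial topology. *)
Lemma locally_compact_closed_subtype (X : topologicalType) (A : set X) :
  closed A -> locally_compact [set: X] -> locally_compact [set: A].
Proof.
move=> cA lcX a _; have [B] := lcX (set_val a) I.
rewrite !withinET => Ba [cB clB].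
exists (set_val @^-1` B); first exact: (@continuous_set_val X A a).
split; last exact: closed_comp (fun x _ => @continuous_set_val X A x) clB.
move=> F FF FB.
have cAB : compact (A `&` B).
  by rewrite setIC; exact: compact_closedI.
have FAB : (set_val @ F) (A `&` B).
  apply: (@filterS _ F _ (set_val @^-1` B)) => // t Bt.
  by split=> //; exact: (set_mem (valP t)).
have [p [[Ap Bp] clp]] := cAB _ _ FAB.
exists (exist _ p (mem_set Ap)); split=> //.
move=> U V FU [_ [[W oW <-] Wp WV]].
have Fim : (set_val @ F) [set set_val t | t in U].
  by apply: (@filterS _ F _ U) => // t Ut; exists t.
have [_ [[t Ut <-] Wt]] := clp _ _ Fim (open_nbhs_nbhs (conj oW Wp)).
by exists t; split=> //; exact: WV.
Qed.

Lemma closed_std_simplex n : closed (std_simplex R n).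
Proof.
rewrite (_ : std_simplex R n =
    \bigcap_(i in [set: 'I_n.+1])
       ((fun v : 'rV[R]_n.+1 => v ord0 i) @^-1` [set x | 0 <= x])
    `&` ((fun v : 'rV[R]_n.+1 => \sum_i v ord0 i) @^-1` [set 1])); last first.
  by apply/seteqP; split=> v [v0 v1]; split=> // i; have := v0 i; exact.
apply: closedI.
- apply: closed_bigI => i _; apply: (proj1 (continuous_closedP _)).
    exact: coord_continuous.
  exact: closed_ge.
- apply: (proj1 (continuous_closedP _)); last exact: closed_eq.
  apply: continuous_big => [|i _]; last exact: coord_continuous.
  exact: add_continuous.
Qed.

Lemma locally_compact_rV n : locally_compact [set: 'rV[R]_n].
Proof.
move=> v _; rewrite withinET.
pose B := [set w : 'rV[R]_n |
  forall i, `[v ord0 i - 1, v ord0 i + 1]%classic (w ord0 i)].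
have cB : compact B.
  apply: (@rV_compact _ _ (fun i => `[v ord0 i - 1, v ord0 i + 1]%classic)).
  by move=> i; exact: segment_compact.
exists B; last first.
  by split=> //; apply: compact_closed cB; exact: norm_hausdorff.
apply/nbhs_ballP; exists 1 => /= [|w [_ vw] i]; first exact: ltr01.
have := vw ord0 i; rewrite -ball_normE /= distrC ltr_distl => /andP[vw1 vw2].
by rewrite /= in_itv /= !ltW.
Qed.

(** One of the maps whose initial topology defines that of [smap R X Y]. *)
Lemma smap_pullback_continuous (X Y : topologicalType)
    (s : singular_simplex R X) : continuous (@smap_pullback R X Y s).
Proof.
move=> f U fU.
have /cvg_sup/(_ s) cf : nbhs f --> f by exact: cvg_id.
by apply: cf; exact: (@initial_continuous _ _ (@smap_pullback R X Y s) f U fU).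
Qed.

(** The initial topology on [smap R X Y] tests convergence only on simplexes,
    while continuity of [k] is about arbitrary compact subsets of [X], which
    need not lie in finitely many simplexes.  The local compactness of [T] is
    what makes up for this: it gives the joint continuity of [k] on
    [T * X], from that of the adjoint of [k] on [X], where simplexes do detect
    continuity. *)
Lemma cmap_continuous_of_smap (X Y T : topologicalType) (h : T -> smap R X Y)
    (k : T -> cmap X Y) :
  locally_compact [set: T] -> regular_space T ->
  numerically_generated R X -> continuous h ->
  (forall t, h t =1 k t) -> continuous k.
Proof.
move=> lcT regT gX hc hk.
have simplexc (s : singular_simplex R X) : continuous
    (fun p : std_simplex R (simplex_dim s) * T => k p.2 (s p.1)).
  pose phi t : {compact-open, std_simplex R (simplex_dim s) -> Y} :=
    fun u => k t (s u).
  have phiE t : phi t = smap_pullback s (h t) :> (_ -> _).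
    by apply/funext => u; exact: (esym (hk t (s u))).
  have phic : continuous phi.
    rewrite (_ : phi = fun t => smap_pullback s (h t) : _ -> _); last first.
      by apply/funext => t; rewrite phiE.
    apply: (@continuous_compf _ (cmap (std_simplex R (simplex_dim s)) Y)).
      exact: continuous_compf hc (@smap_pullback_continuous X Y s).
    exact: initial_continuous.
  have phitc t : continuous (phi t).
    by rewrite phiE; exact: (@smap_numerically_continuous _ _ _ (h t) s).
  have lcD := locally_compact_closed_subtype
    (@closed_std_simplex (simplex_dim s)) (@locally_compact_rV _).
  have uc := continuous_uncurry_regular lcD uniform_regular phic phitc.
  apply: (continuous_compf (f := fun p => (p.2, p.1)) _ uc).
  exact: continuous_pairf (@continuous_sndf _ _) (@continuous_fstf _ _).
pose G x : {compact-open, T -> Y} := fun t => k t x.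
have Gc : continuous G.
  apply/continuousP => U oU; rewrite gX => s.
  have Gsc : continuous (G \o s) by exact: continuous_curry_fun (simplexc s).
  exact: (proj1 (continuousP _) Gsc U oU).
(* Every point of X lies on a constant simplex of dimension 0. *)
have kc x : continuous (fun t => k t x).
  have [s [u su]] : exists (s : singular_simplex R X) u, s u = x.
    have m : std_simplex R 0 (const_mx 1).
      by split=> [i|]; rewrite ?big_ord1 mxE ?ler01.
    exists (SingularSimplex (mkcts (@cst_continuous (std_simplex R 0) X x))).
    by exists (exist (fun v => v \in std_simplex R 0) (const_mx 1)
      (mem_set m)).
  rewrite -su; apply: (continuous_compf (f := fun t => (u, t)) _ (simplexc s)).
  by apply: continuous_pairf; [exact: cst_continuous|move=> ?].
have uc := continuous_uncurry_regular lcT regT Gc kc.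
apply: continuous_comp_initial.
have swapc : continuous (fun p : T * X => k p.1 p.2).
  apply: (continuous_compf (f := fun p => (p.2, p.1)) _ uc).
  exact: continuous_pairf (@continuous_sndf _ _) (@continuous_fstf _ _).
exact: (continuous_curry_fun swapc).
Qed.

End exponential_law.

Theorem proposition5p4 (R : realType) :
  (forall X : ptopologicalType,
     weak_homotopy_equivalence R (counit R X)) /\
  (forall X Y : ptopologicalType,
     numerically_generated R X ->
     weak_homotopy_equivalence R (map_smap_iota R X Y)).
Proof.
split=> [X|X Y gX].
  apply: (@weak_homotopy_equivalence_lift R _ _ (counit R X) id) => // n h.
  exact: counit_lift.
have [g fK gK] := map_smap_iota_bijective Y gX.
apply: (weak_homotopy_equivalence_lift fK gK) => n h hc.
apply: continuous_to_set.
apply: (@cmap_continuous_of_smap R X Y _ (fun v => set_val (h v))) => //.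
- exact: locally_compact_rV.
- exact: uniform_regular.
- exact: continuous_compf hc (@continuous_set_val _ _).
- by move=> v x; rewrite -{1}(gK (h v)).
Qed.
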